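(* Let $0 < m_2 \leq m_1$ be integers. If $$n > \max_{1\leq k\leq m_2}\left(\frac{l}{k}+\frac{m_2-k}{m_1-l}\right),\quad\text{where } l = l(k) = \left\lceil\frac{m_1}{m_2}k\right\rceil - 1,$$ then the log-likelihood $\ell_Y$ of the matrix normal model is bounded from above for a generic matrix tuple $Y\in(\mathbb{R}^{m_1\times m_2})^n$. In other words, $$\mathrm{mlt_b}\leq\left\lfloor\max_{1\leq k\leq m_2}\left(\frac{l}{k}+\frac{m_2-k}{m_1-l}\right)\right\rfloor+1.$$
   Context: $\mathrm{PD}_m$ is the cone of real symmetric positive definite $m\times m$ matrices. For $Y=(Y_1,\dots,Y_n)\in(\mathbb{R}^{m_1\times m_2})^n$, the log-likelihood of the (real) matrix normal model is the function on $\mathrm{PD}_{m_1}\times\mathrm{PD}_{m_2}$ $$\ell_Y(\Psi_1,\Psi_2)=m_2\log\det(\Psi_1)+m_1\log\det(\Psi_2)-\frac1n\mathrm{tr}\Big(\Psi_1\sum_{i=1}^nY_i\Psi_2Y_i^{\mathsf T}\Big).$$ A property holds for generic $Y$ if it holds for all $Y$ away from an algebraic hypersurface in $(\mathbb{R}^{m_1\times m_2})^n$. $\mathrm{mlt_b}=\mathrm{mlt_b}(m_1,m_2)$ is the minimum number $n$ of samples needed for $\ell_Y$ to be bounded from above for generic $Y\in(\mathbb{R}^{m_1\times m_2})^n$. *)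

(* Defs.v *)
From mathcomp Require Import all_boot all_order all_algebra.
From mathcomp Require Import all_classical all_reals all_analysis.
(* Only the canonical structures are imported: the notations of mpoly clash
   with those of mathcomp-analysis. *)
From mathcomp Require Import (canonicals) mpoly.

Set Implicit Arguments.
Unset Strict Implicit.
Unset Printing Implicit Defensive.

Import Order.TTheory GRing.Theory Num.Theory.
Local Open Scope classical_set_scope.
Local Open Scope ring_scope.

Definition PD (R : realType) (m : nat) : set 'M[R]_m :=
  [set A | A^T = A /\
     forall v : 'cV[R]_m, v != 0 -> 0 < (v^T *m A *m v) 0 0].

Arguments PD : clear implicits.

Definition loglik (R : realType) (m1 m2 n : nat)
    (Y : 'I_n -> 'M[R]_(m1, m2)) (Psi1 : 'M[R]_m1) (Psi2 : 'M[R]_m2) : R :=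
  m2%:R * ln (\det Psi1) + m1%:R * ln (\det Psi2)
  - n%:R^-1 * \tr (Psi1 *m \sum_(i < n) (Y i *m Psi2 *m (Y i)^T)).

Definition loglik_bounded_above (R : realType) (m1 m2 n : nat)
    (Y : 'I_n -> 'M[R]_(m1, m2)) : Prop :=
  has_ubound [set loglik Y Psi.1 Psi.2 | Psi in PD R m1 `*` PD R m2].

(* The n * m1 * m2 entries of a tuple, listed in the order of the finite type
   of index triples (sample, row, column). *)
Definition entries (R : realType) (m1 m2 n : nat)
    (Y : 'I_n -> 'M[R]_(m1, m2)) : 'I_#|{: 'I_n * 'I_m1 * 'I_m2}| -> R :=
  fun a => let: (i, r, c) := enum_val a in Y i r c.

(* The hypersurface is the zero locus of a nonzero polynomial in the entries. *)
Definition generically (R : realType) (m1 m2 n : nat)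
    (P : ('I_n -> 'M[R]_(m1, m2)) -> Prop) : Prop :=
  exists2 p : mpoly.mpoly #|{: 'I_n * 'I_m1 * 'I_m2}| R, p != 0 &
    forall Y, mpoly.meval (entries Y) p != 0 -> P Y.

Definition generically_bounded_above (R : realType) (m1 m2 n : nat) : Prop :=
  generically (@loglik_bounded_above R m1 m2 n).

(* Stated as a relation, so that no value is prescribed if no sample size
   works.  The log-likelihood has a factor 1/n, whence 0 < n. *)
Definition is_mltb (R : realType) (m1 m2 N : nat) : Prop :=
  [/\ (0 < N)%N, generically_bounded_above R m1 m2 N &
      forall n, (0 < n)%N -> generically_bounded_above R m1 m2 n -> (N <= n)%N].

Definition lk (m1 m2 k : nat) : int :=
  Num.ceil (m1%:R / m2%:R * k%:R : rat) - 1.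

Definition bound_term (m1 m2 k : nat) : rat :=
  (lk m1 m2 k)%:~R / k%:R + (m2%:R - k%:R) / (m1%:R - (lk m1 m2 k)%:~R).

(* The iterated max starts from the term k = 1, which is in the range as soon
   as 0 < m2, so it is the maximum over 1 <= k <= m2. *)
Definition mlt_bound (m1 m2 : nat) : rat :=
  \big[Num.max/bound_term m1 m2 1]_(1 <= k < m2.+1) bound_term m1 m2 k.

(* Main.v *)
Require Import Defs.
From mathcomp Require Import all_boot all_order all_algebra.
From mathcomp Require Import all_classical all_reals all_analysis.
From mathcomp Require Import perm ring lra.
From mathcomp Require Import -(notations) mpoly.
Import Order.TTheory GRing.Theory Num.Theory.
Import numFieldNormedType.Exports.
Local Open Scope ring_scope.

Set Implicit Arguments.
Unset Strict Implicit.
Unset Printing Implicit Defensive.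

(** Call [Y] shrinking-free if no subspace of dimension [k] is mapped by all the
    [Y i] into a subspace of dimension [t] with [t * m2 < k * m1].

    A shrinking-free [Y] has a bounded log-likelihood.  Write [Psi1 = G D G^T]
    and [Psi2 = H E H^T] with [D], [E] diagonal and [G], [H] in compact sets of
    matrices of determinant [1] or [-1].  The trace term is then
    [tau = sum_(a, b) d_a e_b q_(a, b)], with
    [q_(a, b) = sum_i ((G^T Y_i H)_(a, b))^2].  By compactness there is
    [eps > 0], independent of [G] and [H], such that whenever
    [#|T| * m2 < #|S| * m1], some entry with [a] outside [T] and [b] in [S] has
    [q_(a, b) >= eps]; there [ln d_a + ln e_b <= ln (tau / eps)].  As in
    fractional Hall matching, these inequalities sum up to
    [m2 sum ln d_a + m1 sum ln e_b <= m1 m2 ln (tau / eps)], and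
    [m1 m2 ln (tau / eps) - tau / n] is bounded above over [tau > 0].

    A generic [Y] is shrinking-free: the tuples that shrink some [k]-dimensional
    subspace to dimension [t] form finitely many polynomial images of affine
    spaces of dimension [k (m2 - k) + (m1 - t) t + n (m1 m2 - (m1 - t) k)],
    which is less than [n m1 m2] under the hypothesis on [n]. *)

(** * Algebraic dependence of polynomials *)

(** The rank is at most the number of columns, so the left kernel is nonzero. Arbitrary finite index
    types let families of exponents serve as indices. *)
Lemma wide_left_kernel (F : fieldType) (I J : finType) (A : I -> J -> F) :
  (#|J| < #|I|)%N ->
  exists2 c : I -> F, (exists i, c i != 0) &
    forall j, \sum_i c i * A i j = 0.
Proof.
move=> ltJI.
pose M : 'M[F]_(#|I|, #|J|) := \matrix_(i, j) A (enum_val i) (enum_val j).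
have : kermx M != 0.
  rewrite kermx_eq0 /row_free neq_ltn.
  by rewrite (leq_ltn_trans (rank_leq_col _) ltJI).
case/matrix0Pn=> i0 [i1 nz].
exists (fun i => kermx M i0 (enum_rank i)).
  by exists (enum_val i1); rewrite enum_valK.
move=> j; have /matrixP/(_ i0 (enum_rank j)) := mulmx_ker M.
rewrite !mxE (reindex enum_rank) /=; last exact/onW_bij/enum_rank_bij.
by move=> E; rewrite -[RHS]E; apply: eq_bigr => i _; rewrite !mxE !enum_rankK.
Qed.

(** [msize] is the degree plus one, and [0] for the zero polynomial; the successors turn this into
    additivity of degree bounds. *)
Lemma msize_prod_leq (R : idomainType) (a : nat) (I : finType)
    (f : I -> mpoly a R) (d : I -> nat) :
  (forall i, msize (f i) <= (d i).+1)%N ->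
  (msize (\prod_i f i) <= (\sum_i d i).+1)%N.
Proof.
move=> fd; elim/big_rec2: _ => [|i p q _ IH]; first by rewrite msize1.
have [->|fi0] := eqVneq (f i) 0; first by rewrite mul0r msize0.
have [->|q0] := eqVneq q 0; first by rewrite mulr0 msize0.
rewrite msizeM // -ltnS prednK; last first.
  by rewrite addn_gt0 lt0n msize_poly_eq0 fi0.
by apply: leq_trans (leq_add (fd i) IH) _; rewrite addSn addnS.
Qed.

Lemma msize_exp_leq (R : idomainType) (a : nat) (f : mpoly a R) (d e : nat) :
  (msize f <= d.+1)%N -> (msize (f ^+ e) <= (e * d).+1)%N.
Proof.
move=> fd; have := @msize_prod_leq R a 'I_e (fun=> f) (fun=> d) (fun=> fd).
by rewrite prodr_const sum_nat_const card_ord.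
Qed.

(* Among the [N ^ b] monomials in the [f i] with all exponents below [N], which
   have at most [(b D N + 1) ^ a] coefficients, there is a linear relation once
   [N] is large. *)
Lemma algebraic_dependence (F : fieldType) (a b : nat) (f : 'I_b -> mpoly a F) :
  (a < b)%N ->
  exists2 p : mpoly b F, p != 0 &
    forall v : 'I_a -> F, meval (fun i => meval v (f i)) p = 0.
Proof.
move=> ltab; pose D := (\max_i msize (f i))%N.
(* [N] exceeds [(b D + 1) ^ a], and [M <= N (b D + 1)], so [M ^ a < N ^ (a + 1) <= N ^ b]: fewer
   coefficients than monomials. *)
pose N := ((b * D).+1 ^ a).+1; pose M := (b * (N * D)).+1.
pose g (e : {ffun 'I_b -> 'I_N}) := \prod_i f i ^+ e i.
pose mnm k L (e : {ffun 'I_k -> 'I_L}) :=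
  Multinom [tuple nat_of_ord (e i) | i < k].
have mnm_inj k L : injective (@mnm k L).
  move=> e e' /mnmP E; apply/ffunP => i; apply/val_inj.
  by have := E i; rewrite !mnmE.
have [|c [e0 ce0] cg] := @wide_left_kernel F
    {ffun 'I_b -> 'I_N} {ffun 'I_a -> 'I_M}
    (fun e m => mcoeff (mnm _ _ m) (g e)).
  rewrite !card_ffun !card_ord.
  have MN : (M <= N * (b * D).+1)%N by rewrite /M mulnS mulnCA -add1n leq_add2r.
  have MNa : (M ^ a <= (N * (b * D).+1) ^ a)%N.
    by case: (a) => // a'; rewrite leq_exp2r.
  apply: leq_ltn_trans MNa _.
  rewrite expnMn; apply: leq_trans (_ : N ^ a * N <= _)%N.
    by rewrite ltn_pmul2l ?expn_gt0.
  by rewrite -expnSr leq_pexp2l.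
exists (\sum_e c e *: mpolyX F (mnm _ _ e)).
  apply/eqP => /mpolyP/(_ (mnm _ _ e0)) /eqP; rewrite mcoeff0 raddf_sum /=.
  rewrite (bigD1 e0) //= mcoeffZ mcoeffX eqxx mulr1 big1 ?addr0 ?(negPf ce0) //.
  move=> e ne.
  by rewrite mcoeffZ mcoeffX (inj_eq (@mnm_inj _ _)) (negPf ne) mulr0.
have cg0 : \sum_e c e *: g e = 0.
  apply/mpolyP => m; rewrite mcoeff0 raddf_sum /=.
  have [mM|] := boolP [forall i, (m i < M)%N].
    pose mu := [ffun i => Ordinal (forallP mM i)].
    have -> : m = mnm _ _ mu by apply/mnmP => i; rewrite mnmE ffunE.
    by rewrite -[RHS](cg mu); apply: eq_bigr => e _; rewrite mcoeffZ.
  (* Every [g e] has degree at most [b N D = M - 1], so a monomial with an exponent at least [M]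
     does not occur in it. *)
  rewrite negb_forall => /existsP[i]; rewrite -leqNgt => Mm.
  apply: big1 => e _; rewrite mcoeffZ; apply/eqP; rewrite mulf_eq0 mcoeff_eq0.
  apply/orP; right.
  apply: contraL Mm => /msize_mdeg_lt gm; rewrite -ltnNge.
  have mi : (m i <= mdeg m)%N by rewrite mdegE (bigD1 i) //= leq_addr.
  apply: leq_ltn_trans mi (leq_trans gm _).
  apply: leq_trans (msize_prod_leq (d := fun i => (e i * D)%N) _) _.
    by move=> j; apply: msize_exp_leq; apply: leqW; apply: (leq_bigmax j).
  have eD : (\sum_(j < b) e j * D <= \sum_(j < b) N * D)%N.
    by apply: leq_sum => j _; rewrite leq_mul2r (ltnW (ltn_ord _)) orbT.
  by rewrite sum_nat_const card_ord in eD.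
move=> v; rewrite raddf_sum /= -[RHS](meval0 v) -[in RHS]cg0 raddf_sum /=.
apply: eq_bigr => e _; rewrite !mevalZ mevalX rmorph_prod /=; congr (_ * _).
by apply: eq_bigr => i _; rewrite mnmE rmorphXn.
Qed.

(** * Tuples that shrink a subspace lie in a hypersurface *)

Lemma card_notin_codom (k m : nat) (s : 'I_k -> 'I_m) : injective s ->
  #|[pred a | a \notin codom s]| = (m - k)%N.
Proof.
move=> s_inj.
have := cardC (mem (codom s)); rewrite (card_codom s_inj) !card_ord => E.
by rewrite -[X in (X - _)%N]E addKn; apply: eq_card => a; rewrite !inE.
Qed.

(* In the chart where the rows [t] of [A] and [s] of [B] form identity blocks,
   the block of [Y i] with rows [t] and columns [s] is a polynomial in the other
   entries of [Y i], [A] and [B]. *)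
Lemma chart_hypersurface (R : realType) (m1 m2 n q k : nat)
    (t : 'I_q -> 'I_m1) (s : 'I_k -> 'I_m2) :
  injective t -> injective s ->
  (k * (m2 - k) + q * (m1 - q) < n * (q * k))%N ->
  exists2 p : mpoly #|{: 'I_n * 'I_m1 * 'I_m2}| R, p != 0 &
    forall (Y : 'I_n -> 'M[R]_(m1, m2)) (A : 'M[R]_(m1, q)) (B : 'M[R]_(m2, k)),
      rowsub t A = 1%:M -> rowsub s B = 1%:M ->
      (forall i, A^T *m Y i *m B = 0) -> meval (entries Y) p = 0.
Proof.
move=> t_inj s_inj lt_dim.
pose XA : finType := {u : 'I_m1 * 'I_q | u.1 \notin codom t}.
pose XB : finType := {u : 'I_m2 * 'I_k | u.1 \notin codom s}.
pose pivot (u : 'I_n * ('I_m1 * 'I_m2)) :=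
  (u.2.1 \in codom t) && (u.2.2 \in codom s).
pose XY : finType := {u : 'I_n * ('I_m1 * 'I_m2) | ~~ pivot u}.
pose X : finType := (XA + XB + XY)%type.
(* There are [q (m1 - q)] free entries in [A], [k (m2 - k)] in [B] and [n m1 m2 - n q k] in [Y]. *)
have card_X : (#|X| < #|{: 'I_n * 'I_m1 * 'I_m2}|)%N.
  rewrite !card_sum !card_sig.
  have -> : #|[pred u : 'I_m1 * 'I_q | u.1 \notin codom t]| = ((m1 - q) * q)%N.
    rewrite -(card_notin_codom t_inj) -[X in (_ * X)%N](card_ord q) -cardX.
    by apply: eq_card => -[a b]; rewrite !inE /= andbT.
  have -> : #|[pred u : 'I_m2 * 'I_k | u.1 \notin codom s]| = ((m2 - k) * k)%N.
    rewrite -(card_notin_codom s_inj) -[X in (_ * X)%N](card_ord k) -cardX.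
    by apply: eq_card => -[a b]; rewrite !inE /= andbT.
  have := cardC [pred u | pivot u].
  have -> : #|[pred u | pivot u]| = (n * (q * k))%N.
    rewrite -[X in (X * _)%N](card_ord n) -[in RHS](card_ord q).
    rewrite -[in RHS](card_ord k).
    rewrite -(card_codom t_inj) -(card_codom s_inj) -!cardX.
    by apply: eq_card => -[i [a b]]; rewrite !inE.
  have -> : #|[predC [pred u | pivot u]]| = #|[pred u | ~~ pivot u]|.
    by apply: eq_card => u; rewrite !inE.
  rewrite !card_prod !card_ord => E; rewrite -mulnA -E.
  by rewrite ltn_add2r addnC (mulnC _ k) (mulnC _ q).
(* [None] stands for a pivot entry, which becomes a constant: an entry of the identity block for [A]
   and [B], and [0] for [Y]. *)
pose var (x : option X) (c : R) : mpoly #|X| R :=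
  if x is Some y then mpolyX R (mnm1 (enum_rank y)) else mpolyC _ c.
pose xA a r := omap (fun u : XA => (inl (inl u) : X)) (insub (a, r)).
pose xB b j := omap (fun u : XB => (inl (inr u) : X)) (insub (b, j)).
pose xY i a b := omap (fun u : XY => (inr u : X)) (insub (i, (a, b))).
pose pA a r := var (xA a r) (a == t r)%:R.
pose pB b j := var (xB b j) (b == s j)%:R.
pose pY i a b := var (xY i a b) 0.
(* Solving [(A^T Y_i B)_(r, j) = 0] for the entry [(t r, s j)] of [Y_i] gives minus the contribution
   of the other entries, since the identity blocks isolate it. Off the pivot block one of the outer
   sums is empty and only the variable remains. *)
pose f (u : 'I_#|{: 'I_n * 'I_m1 * 'I_m2}|) : mpoly #|X| R :=
  let: (i, a, b) := enum_val u in
  pY i a b - \sum_(r | t r == a) \sum_(j | s j == b)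
    \sum_a' \sum_b' pA a' r * pY i a' b' * pB b' j.
have [p p0 pf] := algebraic_dependence f card_X.
exists p => // Y A B tA sB AYB.
pose v (u : 'I_#|X|) := match enum_val u with
  | inl (inl w) => A (val w).1 (val w).2
  | inl (inr w) => B (val w).1 (val w).2
  | inr w => Y (val w).1 (val w).2.1 (val w).2.2 end.
have tAE r r' : A (t r) r' = (r == r')%:R.
  by have /matrixP/(_ r r') := tA; rewrite !mxE.
have sBE j j' : B (s j) j' = (j == j')%:R.
  by have /matrixP/(_ j j') := sB; rewrite !mxE.
have vA a r : meval v (pA a r) = A a r.
  rewrite /pA /xA; case: insubP => [w wP /= E|] /=.
    by rewrite mevalXU /v enum_rankK /= E.
  by rewrite negbK => /codomP[r' ->]; rewrite mevalC tAE (inj_eq t_inj).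
have vB a r : meval v (pB a r) = B a r.
  rewrite /pB /xB; case: insubP => [w wP /= E|] /=.
    by rewrite mevalXU /v enum_rankK /= E.
  by rewrite negbK => /codomP[r' ->]; rewrite mevalC sBE (inj_eq s_inj).
have vY i a b : meval v (pY i a b) =
    if (a \in codom t) && (b \in codom s) then 0 else Y i a b.
  rewrite /pY /xY; case: insubP => [w /= /negPf + E|] /=.
    by rewrite /pivot /= => ->; rewrite mevalXU /v enum_rankK /= E.
  by rewrite negbK /pivot /= => ->; rewrite mevalC.
have vS i a b : meval v (\sum_(r | t r == a) \sum_(j | s j == b)
      \sum_a' \sum_b' pA a' r * pY i a' b' * pB b' j) =
    \sum_(r | t r == a) \sum_(j | s j == b) \sum_a' \sum_b' A a' r *
      (if (a' \in codom t) && (b' \in codom s) then 0 else Y i a' b') * B b' j.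
  do 4!(rewrite raddf_sum; apply: eq_bigr => ? _).
  by rewrite /= !mevalM vA vB vY.
rewrite -[RHS](pf v); apply: meval_eq => u; rewrite /entries /f.
case: (enum_val u) => [[i a] b]; rewrite mevalB vY vS.
have [ta|ta] := boolP (a \in codom t); last first.
  rewrite big_pred0 ?subr0 // => r.
  by apply: contraNF ta => /eqP <-; apply: codom_f.
have [sb|sb] := boolP (b \in codom s); last first.
  rewrite big1 ?subr0 // => r _; rewrite big_pred0 // => j.
  by apply: contraNF sb => /eqP <-; apply: codom_f.
case/codomP: ta sb => r -> /codomP[j ->] /=; rewrite sub0r.
rewrite (big_pred1 r); last by move=> r'; rewrite /= (inj_eq t_inj).
rewrite (big_pred1 j); last by move=> r'; rewrite /= (inj_eq s_inj).
have /matrixP/(_ r j) := AYB i; rewrite -mulmxA !mxE => E.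
(* As a double sum against Kronecker deltas, the pivot entry can be matched term by term with the
   expansion of [A^T Y_i B]. *)
have -> : Y i (t r) (s j) = \sum_a' \sum_b'
    (a' == t r)%:R * (b' == s j)%:R * Y i (t r) (s j).
  rewrite (bigD1 (t r)) //= [X in _ + X]big1 ?addr0; last first.
    by move=> a' /negPf ne; apply: big1 => b' _; rewrite ne !mul0r.
  rewrite (bigD1 (s j)) //= !eqxx !mul1r big1 ?addr0 //.
  by move=> b' /negPf ne; rewrite ne mulr0 mul0r.
apply/eqP; rewrite -addr_eq0 -big_split -[X in _ == X]E /=; apply/eqP.
apply: eq_bigr => a' _; rewrite !mxE mulr_sumr -big_split /=.
apply: eq_bigr => b' _.
have [/andP[/codomP[r' ->] /codomP[j' ->]]|nts] :=
  boolP ((a' \in codom t) && (b' \in codom s)).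
  rewrite mulr0 mul0r addr0 tAE sBE (inj_eq t_inj) (inj_eq s_inj).
  by have [->|_] := eqVneq r' r; have [->|_] := eqVneq j' j;
    rewrite !(mul0r, mulr0, mul1r, mulr1).
have -> : (a' == t r)%:R * (b' == s j)%:R = 0 :> R.
  rewrite -natrM mulnb.
  have [ea|//] := eqVneq a' (t r); have [eb|//] := eqVneq b' (s j).
  by rewrite ea eb !codom_f in nts.
by rewrite mul0r add0r mulrA.
Qed.

Lemma generically_sub (R : realType) (m1 m2 n : nat)
    (P Q : ('I_n -> 'M[R]_(m1, m2)) -> Prop) :
  (forall Y, P Y -> Q Y) -> generically P -> generically Q.
Proof. by move=> PQ [p p0 pP]; exists p => // Y /pP /PQ. Qed.

(** A finite union of hypersurfaces is cut out by the product of their equations. *)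
Lemma generically_forall (R : realType) (m1 m2 n : nat) (I : finType)
    (P : I -> ('I_n -> 'M[R]_(m1, m2)) -> Prop) :
  (forall i, generically (P i)) -> generically (fun Y => forall i, P i Y).
Proof.
move=> gP.
have /choice[p pP] : forall i, exists p : mpoly #|{: 'I_n * 'I_m1 * 'I_m2}| R,
    p != 0 /\ forall Y, meval (entries Y) p != 0 -> P i Y.
  by move=> i; have [p p0 pP] := gP i; exists p.
exists (\prod_i p i); first by apply/prodf_neq0 => i _; have [] := pP i.
move=> Y; rewrite rmorph_prod => /prodf_neq0 pY i.
by have [_] := pP i; apply; apply: pY.
Qed.

Lemma generically_imply (R : realType) (m1 m2 n : nat) (C : bool)
    (P : ('I_n -> 'M[R]_(m1, m2)) -> Prop) :
  (C -> generically P) -> generically (fun Y => C -> P Y).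
Proof.
case: C => [|_]; last by exists 1; rewrite ?oner_neq0.
by move=> /(_ isT); apply: generically_sub.
Qed.

(** A matrix of full column rank has an invertible block of rows. Multiplying by the inverse of that
    block on the right moves the matrix into one of finitely many charts and preserves the vanishing
    of the products. *)
Lemma generically_full_rank_product_neq0 (R : realType) (m1 m2 n q k : nat) :
  (k * (m2 - k) + q * (m1 - q) < n * (q * k))%N ->
  generically (fun Y : 'I_n -> 'M[R]_(m1, m2) =>
    forall (A : 'M[R]_(m1, q)) (B : 'M[R]_(m2, k)),
      row_full A -> row_full B -> exists i, A^T *m Y i *m B != 0).
Proof.
move=> lt_dim.
pose P (ts : {ffun 'I_q -> 'I_m1} * {ffun 'I_k -> 'I_m2})
    (Y : 'I_n -> 'M[R]_(m1, m2)) :=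
  injectiveb ts.1 && injectiveb ts.2 ->
  forall (A : 'M[R]_(m1, q)) (B : 'M[R]_(m2, k)),
    rowsub ts.1 A = 1%:M -> rowsub ts.2 B = 1%:M ->
    ~ (forall i, A^T *m Y i *m B = 0).
apply: (@generically_sub _ _ _ _ (fun Y => forall ts, P ts Y)); last first.
  apply: generically_forall => ts; apply: generically_imply.
  case/andP=> /injectiveP t_inj /injectiveP s_inj.
  have [p p0 pP] := chart_hypersurface R t_inj s_inj lt_dim.
  by exists p => // Y pY A B tA sB AYB; rewrite (pP Y A B) ?eqxx in pY.
move=> Y PY A B fA fB; apply: contrapT => AYB.
pose WA := rowsub (fullrankfun fA) A; pose WB := rowsub (fullrankfun fB) B.
have uA : WA \in unitmx by rewrite -row_full_unit fullrowsub_full.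
have uB : WB \in unitmx by rewrite -row_full_unit fullrowsub_full.
apply: (PY (fullrankfun fA, fullrankfun fB) _
  (A *m invmx WA) (B *m invmx WB)) => /=.
- by apply/andP; split; apply/injectiveP; apply: fullrankfun_inj.
- by rewrite -mul_rowsub_mx mulmxV.
- by rewrite -mul_rowsub_mx mulmxV.
move=> i; have AYBi : A^T *m Y i *m B = 0.
  by apply/eqP; apply: contrapT => /negP ne; apply: AYB; exists i.
by rewrite trmx_mul mulmxA -(mulmxA _ A^T) -(mulmxA _ _ B) AYBi mulmx0 mul0mx.
Qed.

(* If all these entries vanished, every [Y i] would map the span of the columns
   [S] of [H] into the orthogonal complement, of dimension [#|T|], of the span
   of the columns of [G] outside [T]. *)
Definition shrinking_free (R : realType) (m1 m2 n : nat)
    (Y : 'I_n -> 'M[R]_(m1, m2)) :=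
  forall (G : 'M[R]_m1) (H : 'M[R]_m2) (T : {set 'I_m1}) (S : {set 'I_m2}),
    G \in unitmx -> H \in unitmx -> (#|T| * m2 < #|S| * m1)%N ->
    exists i a b, [/\ a \notin T, b \in S & (G^T *m Y i *m H) a b != 0].

Lemma row_full_colsub (F : fieldType) (m k : nat)
    (f : 'I_k -> 'I_m) (G : 'M[F]_m) :
  injective f -> G \in unitmx -> row_full (colsub f G).
Proof.
move=> f_inj uG; apply/row_fullP; exists (rowsub f (invmx G)).
rewrite -mxsub_mul mulVmx //; apply/matrixP => i j.
by rewrite !mxE (inj_eq f_inj).
Qed.

(** For each of the finitely many pairs [(T, S)], the columns of [G] outside [T] and of [H] in [S]
    form matrices of full column rank, to which the previous result applies with [q = m1 - #|T|] and
    [k = #|S|]. *)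
Lemma generically_shrinking_free (R : realType) (m1 m2 n : nat) :
  (forall k t, (k <= m2)%N -> (t * m2 < k * m1)%N ->
    (k * (m2 - k) + (m1 - t) * t < n * ((m1 - t) * k))%N) ->
  generically (@shrinking_free R m1 m2 n).
Proof.
move=> lt_dim.
pose P (TS : {set 'I_m1} * {set 'I_m2}) (Y : 'I_n -> 'M[R]_(m1, m2)) :=
  (#|TS.1| * m2 < #|TS.2| * m1)%N ->
  forall (A : 'M[R]_(m1, #|~: TS.1|)) (B : 'M[R]_(m2, #|TS.2|)),
    row_full A -> row_full B -> exists i, A^T *m Y i *m B != 0.
apply: (@generically_sub _ _ _ _ (fun Y => forall TS, P TS Y)); last first.
  apply: generically_forall => -[T S]; apply: generically_imply => /= ltTS.
  apply: generically_full_rank_product_neq0.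
  have cT := cardsC T; rewrite card_ord in cT.
  have Tm1 : (#|T| <= m1)%N by have := leq_addr #|~: T| #|T|; rewrite cT.
  have -> : #|~: T| = (m1 - #|T|)%N by rewrite -(addKn #|T| #|~: T|) cT.
  rewrite subKn //; apply: lt_dim => //.
  by have := max_card (mem S); rewrite card_ord.
move=> Y PY G H T S uG uH ltTS.
have [||i] := PY (T, S) ltTS (colsub enum_val G) (colsub enum_val H).
- by apply: row_full_colsub => //; apply: enum_val_inj.
- by apply: row_full_colsub => //; apply: enum_val_inj.
case/matrix0Pn=> a [b nz]; exists i, (enum_val a), (enum_val b); split.
- by have := enum_valP a; rewrite inE.
- exact: enum_valP.
apply: contra nz => /eqP <-; rewrite trmx_mxsub.
by rewrite mul_rowsub_mx -mxsub_mul mxE.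
Qed.

(** * Factorization of positive definite matrices *)

Lemma quadratic_form_line (R : realType) (m : nat)
    (A : 'M[R]_m) (x y : 'cV[R]_m) (c : R) :
  A^T = A ->
  ((x + c *: y)^T *m A *m (x + c *: y)) 0 0 =
  (x^T *m A *m x) 0 0 + c *+ 2 * (y^T *m A *m x) 0 0 +
  c ^+ 2 * (y^T *m A *m y) 0 0.
Proof.
move=> symA.
have E : (x^T *m A *m y) 0 0 = (y^T *m A *m x) 0 0.
  have <- : (x^T *m A *m y)^T 0 0 = (x^T *m A *m y) 0 0 by rewrite mxE.
  by rewrite !trmx_mul symA trmxK mulmxA.
have -> : (x + c *: y)^T = x^T + c *: y^T by rewrite linearD linearZ.
rewrite !mulmxDl !mulmxDr -!scalemxAl -!scalemxAr.
set X := x^T *m A *m x; set Z := y^T *m A *m y.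
move: E; set Y1 := x^T *m A *m y; set Y2 := y^T *m A *m x => E.
clearbody X Z Y1 Y2; rewrite !mxE E; ring.
Qed.

Lemma quadratic_form_delta (R : realType) (m : nat)
    (A : 'M[R]_m) (i j : 'I_m) :
  ((delta_mx i 0 : 'cV[R]_m)^T *m A *m (delta_mx j 0 : 'cV[R]_m)) 0 0 = A i j.
Proof. by rewrite trmx_delta -rowE -colE !mxE. Qed.

Lemma quadratic_formE (R : realType) (m : nat)
    (A : 'M[R]_m) (x : 'cV[R]_m) :
  (x^T *m A *m x) 0 0 = \sum_i \sum_j x i 0 * A i j * x j 0.
Proof.
rewrite exchange_big mxE /=; apply: eq_bigr => j _.
by rewrite mxE mulr_suml; apply: eq_bigr => i _; rewrite mxE.
Qed.

Lemma PD_diag_gt0 (R : realType) (m : nat) (A : 'M[R]_m) (i : 'I_m) :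
  PD R m A -> 0 < A i i.
Proof.
case=> _ posA; rewrite -quadratic_form_delta; apply: posA.
by apply/matrix0Pn; exists i, 0; rewrite mxE !eqxx oner_neq0.
Qed.

(** Positivity at [e_i + e_j] and [e_i - e_j] bounds twice the off-diagonal entry by the sum of the
    two diagonal ones. *)
Lemma PD_offdiag_le (R : realType) (m : nat) (A : 'M[R]_m) (i j : 'I_m) :
  PD R m A -> A i i <= A j j -> `|A i j| <= A j j.
Proof.
move=> pdA le_ij; have [->|ne_ij] := eqVneq i j.
  by rewrite ger0_norm // ltW // PD_diag_gt0.
have [symA posA] := pdA.
have pos c : 0 < A i i + c *+ 2 * A j i + c ^+ 2 * A j j.
  rewrite -(quadratic_form_delta A i i) -(quadratic_form_delta A j i).
  rewrite -(quadratic_form_delta A j j) -quadratic_form_line //; apply: posA.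
  apply/matrix0Pn; exists i, 0.
  by rewrite !mxE !eqxx (negPf ne_ij) mulr0 addr0 oner_neq0.
have Aji : A j i = A i j by rewrite -[in LHS]symA mxE.
have := pos 1; have := pos (-1); rewrite Aji ler_norml => H1 H2.
apply/andP; split; lra.
Qed.

Lemma PD_schur (R : realType) (m : nat) (A : 'M[R]_m.+1) (i0 : 'I_m.+1) :
  PD R m.+1 A ->
  PD R m (\matrix_(i, j)
    (A (lift i0 i) (lift i0 j) -
     A (lift i0 i) i0 * A (lift i0 j) i0 / A i0 i0)).
Proof.
move=> pdA; have [symA posA] := pdA; have a_gt0 := PD_diag_gt0 i0 pdA.
have sym i j : A i j = A j i by rewrite -[in LHS]symA mxE.
split; first by apply/matrixP => i j; rewrite !mxE sym [X in X / _]mulrC.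
move=> w w0.
pose u : 'cV[R]_m.+1 := \col_i oapp (w ^~ 0) 0 (unlift i0 i).
pose e : 'cV[R]_m.+1 := delta_mx i0 0.
pose r := (e^T *m A *m u) 0 0.
have u0 : u i0 0 = 0 by rewrite mxE unlift_none.
have uE j : u (lift i0 j) 0 = w j 0 by rewrite mxE liftK.
have rE : r = \sum_j A i0 (lift i0 j) * w j 0.
  rewrite /r trmx_delta -rowE mxE (bigD1_ord i0) //=.
  rewrite !mxE unlift_none /= mulr0 add0r.
  by apply: eq_bigr => j _; rewrite !mxE liftK.
set S := \matrix_(i, j) _.
have -> : (w^T *m S *m w) 0 0 = (u^T *m A *m u) 0 0 - r ^+ 2 / A i0 i0.
  rewrite !quadratic_formE rE expr2 big_distrlr mulr_suml.
  rewrite [in RHS](bigD1_ord i0) //=.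
  have -> : \sum_j u i0 0 * A i0 j * u j 0 = 0.
    by apply: big1 => j _; rewrite u0 !mul0r.
  rewrite add0r.
  rewrite -sumrB; apply: eq_bigr => i _.
  rewrite [in RHS](bigD1_ord i0) //= u0 mulr0 add0r mulr_suml.
  rewrite -sumrB; apply: eq_bigr => j _.
  by rewrite !uE mxE (sym i0) (sym i0); ring.
(* The Schur complement form at [w] is the minimum of the form of [A] on the line through [u] with
   direction [e], attained at this point. *)
have := posA (u + (- (r / A i0 i0)) *: e).
rewrite quadratic_form_line // quadratic_form_delta -/r.
have -> : (u^T *m A *m u) 0 0 - r ^+ 2 / A i0 i0 =
  (u^T *m A *m u) 0 0 + - (r / A i0 i0) *+ 2 * r +
  (- (r / A i0 i0)) ^+ 2 * A i0 i0.
  by field; rewrite gt_eqF.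
apply; have /matrix0Pn[j [z wj]] := w0.
apply/matrix0Pn; exists (lift i0 j), 0.
rewrite mxE uE !mxE [lift _ _ == _]eq_sym (negPf (neq_lift _ _)).
by rewrite mulr0 addr0 -(ord1 z).
Qed.

(* Diagonal pivoting keeps all entries of the triangular factor in [-1, 1], so
   that the factors [G] range over a compact set. *)
Lemma PD_pivoted_LDL (R : realType) (m : nat) (A : 'M[R]_m) : PD R m A ->
  exists (G : 'M[R]_m) (d : 'rV[R]_m),
    [/\ forall i j, `|G i j| <= 1, \det G ^+ 2 = 1, forall j, 0 < d 0 j
      & A = G *m diag_mx d *m G^T].
Proof.
elim: m A => [|m IH] A pdA.
  exists 1%:M, 0; split; [by case|by rewrite det1 expr1n|by case|].
  by apply/matrixP; case.
have [i0 _ max_i0] :=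
  arg_maxP (fun i => A i i) (erefl : predT (ord0 : 'I_m.+1)).
have [G' [d' [G'1 detG' d'_gt0 AE]]] := IH _ (PD_schur i0 pdA).
have a_gt0 := PD_diag_gt0 i0 pdA.
(* Column [0] is the pivot column of [A] scaled to have [1] in row [i0]; the other columns are those
   of [G'] with a [0] inserted in row [i0]. Expanding along row [i0] gives the determinant of [G']
   up to sign. *)
pose G : 'M[R]_m.+1 := \matrix_(i, j)
  if unlift 0 j is Some j' then oapp (G' ^~ j') 0 (unlift i0 i)
  else A i i0 / A i0 i0.
pose d : 'rV[R]_m.+1 := \row_j oapp (d' 0) (A i0 i0) (unlift 0 j).
exists G, d; split.
- move=> i j; rewrite mxE; case: unliftP => [j' _|_].
    by case: unliftP => [i' _|_] //=; rewrite normr0.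
  rewrite normrM normfV (gtr0_norm a_gt0) ler_pdivrMr // mul1r.
  by apply: PD_offdiag_le => //; apply: max_i0.
- rewrite (expand_det_row _ i0) big_ord_recl big1 ?addr0; last first.
    by move=> j _; rewrite mxE liftK unlift_none mul0r.
  rewrite mxE !unlift_none divff ?gt_eqF // mul1r /cofactor exprMn.
  rewrite sqrr_sign mul1r.
  rewrite -detG'; congr (\det _ ^+ 2); apply/matrixP => i j.
  by rewrite !mxE !liftK.
- by move=> j; rewrite mxE; case: unliftP => [j' _|_] /=.
apply/matrixP => i k.
have -> : (G *m diag_mx d *m G^T) i k = \sum_j G i j * d 0 j * G k j.
  by rewrite mxE; apply: eq_bigr => j _; rewrite mul_mx_diag !mxE.
rewrite big_ord_recl !mxE unlift_none /=.
under eq_bigr => j _ do rewrite !mxE !liftK /=.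
have symA : A^T = A by have [] := pdA.
have sym x y : A x y = A y x by rewrite -[in LHS]symA mxE.
case: (unliftP i0 i) => [i' ->|->] /=; last first.
  rewrite big1 ?addr0; last by move=> j _; rewrite !mul0r.
  by rewrite sym; field; rewrite gt_eqF.
case: (unliftP i0 k) => [k' ->|->] /=; last first.
  rewrite big1 ?addr0; last by move=> j _; rewrite !mulr0.
  by field; rewrite gt_eqF.
have /matrixP/(_ i' k') := AE; rewrite mxE.
have -> : (G' *m diag_mx d' *m G'^T) i' k' = \sum_j G' i' j * d' 0 j * G' k' j.
  by rewrite mxE; apply: eq_bigr => j _; rewrite mul_mx_diag !mxE.
move=> <-; field; by rewrite gt_eqF.
Qed.

(** * Compactness and the uniform gap *)

Section ContinuousMatrix.
Variables (R : realType) (T : topologicalType).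

Lemma continuous_fsum (I : Type) (r : seq I) (P : pred I) (F : I -> T -> R) :
  (forall i, P i -> continuous (F i)) ->
  continuous (fun x => \sum_(i <- r | P i) F i x).
Proof. by move=> cF; apply: continuous_big => //; apply: add_continuous. Qed.

Lemma continuous_fprod (I : Type) (r : seq I) (P : pred I) (F : I -> T -> R) :
  (forall i, P i -> continuous (F i)) ->
  continuous (fun x => \prod_(i <- r | P i) F i x).
Proof. by move=> cF; apply: continuous_big => //; apply: mul_continuous. Qed.

Definition mx_continuous (m n : nat) (M : T -> 'M[R]_(m, n)) :=
  forall i j, continuous (fun x => M x i j).

Lemma mx_continuous_cst (m n : nat) (A : 'M[R]_(m, n)) :
  mx_continuous (fun=> A).
Proof. by move=> i j; apply: cst_continuous. Qed.

Lemma mx_continuous_tr (m n : nat) (M : T -> 'M[R]_(m, n)) :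
  mx_continuous M -> mx_continuous (fun x => (M x)^T).
Proof.
move=> cM i j; rewrite [X in continuous X](_ : _ = fun x => M x j i) //.
by apply/funext => x; rewrite mxE.
Qed.

Lemma mx_continuousM (m n p : nat)
    (M : T -> 'M[R]_(m, n)) (N : T -> 'M[R]_(n, p)) :
  mx_continuous M -> mx_continuous N ->
  mx_continuous (fun x => M x *m N x).
Proof.
move=> cM cN i j.
rewrite [X in continuous X](_ : _ = fun x => \sum_k M x i k * N x k j);
  last by apply/funext => x; rewrite mxE.
by apply: continuous_fsum => k _ x; apply: continuousM; [apply: cM|apply: cN].
Qed.

Lemma continuous_det (m : nat) (M : T -> 'M[R]_m) :
  mx_continuous M -> continuous (fun x => \det (M x)).
Proof.
move=> cM.
rewrite [X in continuous X](_ : _ = fun x =>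
  \sum_(s : 'S_m) (-1) ^+ s * \prod_i M x i (s i)) //.
apply: continuous_fsum => s _ x.
have term : {for x, continuous
    ((fun=> (-1) ^+ s : R) \* (fun x => \prod_i M x i (s i)))}.
  apply: continuousM; first exact: cst_continuous.
  by move: x; apply: continuous_fprod => i _; apply: cM.
exact: term.
Qed.

End ContinuousMatrix.

Lemma finite_pos_bound (R : realType) (I : finType) (P : I -> R -> Prop) :
  (forall i d e, P i d -> e <= d -> P i e) ->
  (forall i, exists2 d, 0 < d & P i d) ->
  exists2 d, 0 < d & forall i, P i d.
Proof.
move=> mono ex.
have /choice[d dP] : forall i, exists d, 0 < d /\ P i d.
  by move=> i; have [d d0 Pd] := ex i; exists d.
exists (\big[Order.min/1]_i d i).
  by apply: lt_bigmin => // i _; have [] := dP i.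
by move=> i; have [_ /mono] := dP i; apply; apply: bigmin_le.
Qed.

Lemma cube_compact (R : realType) (N : nat) :
  compact [set v : 'rV[R]_N | forall i, `|v ord0 i| <= 1]%classic.
Proof.
have -> : [set v : 'rV[R]_N | forall i, `|v ord0 i| <= 1]%classic =
    [set v : 'rV[R]_N | forall i, `[-1, 1] (v ord0 i)]%classic.
  by apply/seteqP; split => v vi i; have := vi i;
    rewrite /= in_itv /= ler_norml.
have := @rV_compact R N (fun=> `[-1, 1]%classic)
  (fun=> @segment_compact R _ _).
exact.
Qed.

(** A compact set containing the factors given by [PD_pivoted_LDL]. The determinant condition is
    closed, yet forces invertibility. *)
Definition bounded_unimodular (R : realType) (m : nat) (G : 'M[R]_m) :=
  (forall i j, `|G i j| <= 1) /\ \det G ^+ 2 = 1.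

Lemma bounded_unimodular_unit (R : realType) (m : nat) (G : 'M[R]_m) :
  bounded_unimodular G -> G \in unitmx.
Proof.
case=> _ dG; rewrite unitmxE unitfE; apply: contra_eq_neq dG => ->.
by rewrite expr0n eq_sym oner_neq0.
Qed.

(** For fixed [T] and [S] the sum is continuous in [(G, H)] and attains its minimum on a compact
    set, where some square is nonzero. There are finitely many pairs [(T, S)]. *)
Lemma shrinking_free_gap (R : realType) (m1 m2 n : nat)
    (Y : 'I_n -> 'M[R]_(m1, m2)) : shrinking_free Y ->
  exists2 delta : R, 0 < delta &
    forall (T : {set 'I_m1}) (S : {set 'I_m2}) (G : 'M[R]_m1) (H : 'M[R]_m2),
      (#|T| * m2 < #|S| * m1)%N ->
      bounded_unimodular G -> bounded_unimodular H ->
      delta <= \sum_(a in ~: T) \sum_(b in S)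
        \sum_i ((G^T *m Y i *m H) a b) ^+ 2.
Proof.
move=> freeY.
suff: exists2 delta : R, 0 < delta & forall TS : {set 'I_m1} * {set 'I_m2},
    (#|TS.1| * m2 < #|TS.2| * m1)%N ->
    forall (G : 'M[R]_m1) (H : 'M[R]_m2),
    bounded_unimodular G -> bounded_unimodular H ->
    delta <= \sum_(a in ~: TS.1) \sum_(b in TS.2)
      \sum_i ((G^T *m Y i *m H) a b) ^+ 2.
  by case=> d d0 dP; exists d => // T S G H lt_TS; apply: (dP (T, S)).
apply: finite_pos_bound => [TS d e dP led lt_TS G H bG bH|[T S] /=].
  by apply: le_trans led _; apply: dP.
have [lt_TS|] := boolP (#|T| * m2 < #|S| * m1)%N; last by exists 1.
(* The entries of [G] and [H] are stacked into one row vector, so that [K] is a closed subset of a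
   compact cube. *)
pose N := (m1 * m1 + m2 * m2)%N.
pose g (v : 'rV[R]_N) : 'M[R]_m1 := vec_mx (lsubmx v).
pose h (v : 'rV[R]_N) : 'M[R]_m2 := vec_mx (rsubmx v).
pose f v := \sum_(a in ~: T) \sum_(b in S)
  \sum_i (((g v)^T *m Y i *m h v) a b) ^+ 2.
pose K := [set v : 'rV[R]_N |
  bounded_unimodular (g v) /\ bounded_unimodular (h v)]%classic.
have cg : mx_continuous g.
  move=> i j; rewrite [X in continuous X](_ : _ =
      fun v : 'rV[R]_N => v 0 (lshift _ (mxvec_index i j)));
    last by apply/funext => v; rewrite !mxE.
  exact: coord_continuous.
have ch : mx_continuous h.
  move=> i j; rewrite [X in continuous X](_ : _ =
      fun v : 'rV[R]_N => v 0 (rshift _ (mxvec_index i j)));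
    last by apply/funext => v; rewrite !mxE.
  exact: coord_continuous.
have sqr_cont (u : 'rV[R]_N -> R) :
    continuous u -> continuous (fun v => u v ^+ 2).
  by move=> cu v; apply: continuousM; apply: cu.
have cf : continuous f.
  do 3!(apply: continuous_fsum => ? _); apply: sqr_cont.
  apply: mx_continuousM => //.
  apply: mx_continuousM; last exact: mx_continuous_cst.
  exact: mx_continuous_tr.
have bu1 m : bounded_unimodular (1%:M : 'M[R]_m).
  split=> [i j|]; last by rewrite det1 expr1n.
  by rewrite mxE; case: (_ == _); rewrite ?normr1 ?normr0.
have K0 : (K !=set0)%classic.
  exists (row_mx (mxvec 1%:M) (mxvec 1%:M)).
  by rewrite /K /= /g /h row_mxKl row_mxKr !mxvecK.
have det1_closed m (M : 'rV[R]_N -> 'M[R]_m) : mx_continuous M ->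
    closed [set v | \det (M v) ^+ 2 = 1]%classic.
  move=> cM; apply: (@preimage_closed _ _
    (fun v => \det (M v) ^+ 2) [set x | x = 1]%classic).
    by move=> v _; apply: sqr_cont; apply: continuous_det.
  exact: closed_eq.
have KE : K = ([set v : 'rV[R]_N | forall i, `|v ord0 i| <= 1] `&`
    ([set v | \det (g v) ^+ 2 = 1] `&` [set v | \det (h v) ^+ 2 = 1]))%classic.
  apply/seteqP; split => v.
    move=> [[g1 gd] [h1 hd]]; split => // i.
    case: (split_ordP i) => j ->; case/mxvec_indexP: j => a b.
      by have := g1 a b; rewrite !mxE.
    by have := h1 a b; rewrite !mxE.
  move=> [v1 [gd hd]]; split; split => // a b; rewrite !mxE.
    exact: v1.
  exact: v1.
have cK : compact K.
  rewrite KE; apply: compact_closedI; first exact: cube_compact.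
  by apply: closedI; apply: det1_closed.
have [v vK vmin] := compact_EVT_min K0 cK (continuous_subspaceT cf).
have [gv hv] : bounded_unimodular (g v) /\ bounded_unimodular (h v).
  by rewrite inE in vK.
exists (f v).
  have [i [a [b [aT bS nz]]]] := freeY (g v) (h v) T S
    (bounded_unimodular_unit gv) (bounded_unimodular_unit hv) lt_TS.
  have sq_ge0 (i' : 'I_n) a' b' : 0 <= (((g v)^T *m Y i' *m h v) a' b') ^+ 2.
    exact: sqr_ge0.
  rewrite /f (bigD1 a) ?inE //= (bigD1 b) //= (bigD1 i) //=.
  rewrite -!addrA ltr_wpDr ?exprn_even_gt0 //.
  by rewrite !addr_ge0 //; do ?(apply: sumr_ge0 => ? _).
move=> _ G H bG bH.
have := vmin (row_mx (mxvec G) (mxvec H)).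
rewrite inE /K /= /f /g /h row_mxKl row_mxKr !mxvecK; apply; split => //.
Qed.

(** * Fractional Hall inequality *)

(* The proof is Abel summation over the sorted values of [z]. *)
Lemma superlevel_sum_ge0 (R : realDomainType) (I : finType) (w z : I -> R) :
  \sum_i w i = 0 -> (forall s, 0 <= \sum_(i | s < z i) w i) ->
  0 <= \sum_i w i * z i.
Proof.
move=> w_sum0 w_ge0.
pose c := sort <=%R (codom z).
have c_sorted : sorted <=%R c by apply: sort_sorted; apply: le_total.
(* [z i] is the least value plus the gaps of the sorted list below it. The least value drops out
   since the weights sum to zero, and each gap is multiplied by a superlevel sum. *)
have zE i : z i = c`_0 +
    \sum_(0 <= j < (size c).-1) (c`_j.+1 - c`_j) * (c`_j < z i)%R%:R.
  have zc : z i \in c by rewrite mem_sort codom_f.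
  set k := index (z i) c; have kc : (k < size c)%N by rewrite index_mem.
  have ck : z i = c`_k by rewrite nth_index.
  have kc' : (k <= (size c).-1)%N by rewrite -ltnS (ltn_predK kc).
  rewrite (big_cat_nat (n := k)) //= [X in _ + (_ + X)]big1_seq ?addr0;
      last first.
    move=> j /=; rewrite mem_index_iota => /andP[kj jc].
    rewrite ck ltNge (sorted_leq_nth le_trans le_refl) ?inE ?mulr0 //.
    by rewrite -(ltn_predK kc) ltnS ltnW.
  rewrite (eq_big_nat _ _ (F2 := fun j => c`_j.+1 - c`_j)) => [|j /= jk].
    by rewrite telescope_sumr // addrC subrK.
  have jc : (j.+1 < size c)%N by apply: leq_ltn_trans jk kc.
  have [|zj] := ltP; first by rewrite mulr1.
  (* Here both ends of the gap equal [z i], a repeated value in the list, so the gap is zero. *)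
  rewrite mulr0; apply/esym/eqP; rewrite subr_eq0 eq_le; apply/andP; split.
    by apply: le_trans zj; rewrite ck; apply: (sorted_leq_nth le_trans le_refl).
  by apply: (sorted_leq_nth le_trans le_refl) => //; apply: ltnW.
under eq_bigr => i _ do rewrite zE mulrDr mulr_sumr.
rewrite big_split /= -mulr_suml w_sum0 mul0r add0r exchange_big /= big_seq.
apply: sumr_ge0 => j; rewrite mem_index_iota => /andP[_ jc].
have jc' : (j.+1 < size c)%N by case: (size c) jc.
under eq_bigr => i _ do rewrite mulrCA.
rewrite -mulr_sumr mulr_ge0 //.
  rewrite subr_ge0; apply: (sorted_leq_nth le_trans le_refl) => //.
  by rewrite inE ltnW.
have := w_ge0 c`_j; rewrite big_mkcond.
by under eq_bigr => i _ do rewrite -mulrb -mulr_natr.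
Qed.

(** The weights [m2] on rows and [- m1] on columns cancel in total. If a superlevel set of [t - x],
    [y] had negative weight, [edge] would give [a] and [b] with [t - x a <= s < y b], against
    [x a + y b <= t]. *)
Lemma weighted_sum_le (R : realDomainType) (m1 m2 : nat) (x : 'I_m1 -> R)
    (y : 'I_m2 -> R) (t : R) :
  (forall (T : {set 'I_m1}) (S : {set 'I_m2}), (#|T| * m2 < #|S| * m1)%N ->
    exists a b, [/\ a \notin T, b \in S & x a + y b <= t]) ->
  m2%:R * (\sum_a x a) + m1%:R * (\sum_b y b) <= (m1 * m2)%:R * t.
Proof.
move=> edge.
pose w (u : 'I_m1 + 'I_m2) : R := if u is inl _ then m2%:R else - m1%:R.
pose z (u : 'I_m1 + 'I_m2) : R :=
  match u with inl a => t - x a | inr b => y b end.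
have wz : \sum_u w u * z u = (m1 * m2)%:R * t -
    (m2%:R * (\sum_a x a) + m1%:R * (\sum_b y b)).
  rewrite big_sumType /= -!mulr_sumr sumrB sumr_const card_ord natrM.
  by rewrite -mulr_natl; ring.
rewrite -subr_ge0 -wz; apply: superlevel_sum_ge0 => [|s].
  by rewrite big_sumType /= !sumr_const !card_ord mulNrn -!mulrnA mulnC subrr.
rewrite big_sumType /= !sumr_const mulNrn subr_ge0 -!mulrnA ler_nat leqNgt.
rewrite (mulnC m1) (mulnC m2).
apply/negP => lt_TS.
have [|a [b [aT bS xy]]] := edge [set a | s < t - x a] [set b | s < y b].
  by rewrite !cardsE.
rewrite !inE in aT bS; rewrite -leNgt in aT.
move: xy; rewrite leNgt => /negP; apply.
by rewrite -subr_gt0; have := bS; rewrite -subr_gt0; lra.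
Qed.

(** * Boundedness for shrinking-free tuples *)

Lemma ln_prod (R : realType) (I : finType) (d : I -> R) :
  (forall i, 0 < d i) -> ln (\prod_i d i) = \sum_i ln (d i).
Proof.
move=> d0.
suff [] : 0 < \prod_i d i /\ ln (\prod_i d i) = \sum_i ln (d i) by [].
elim/big_rec2: _ => [|i p q _ [q0 <-]]; first by rewrite ln1.
by split; rewrite ?mulr_gt0 // lnM ?posrE.
Qed.

(** With [s = c t / M], the left side is [M (ln s - s) + M ln (M / (c e))], and [ln s < s]. *)
Lemma log_linear_le (R : realType) (M c e t : R) :
  0 < M -> 0 < c -> 0 < e -> 0 < t ->
  M * ln (t / e) - c * t <= M * ln (M / (c * e)).
Proof.
move=> M0 c0 e0 t0.
have s0 : 0 < c * t / M by rewrite divr_gt0 ?mulr_gt0.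
have -> : t / e = (c * t / M) * (M / (c * e)).
  by field; rewrite !gt_eqF.
rewrite lnM ?posrE ?divr_gt0 ?mulr_gt0 // mulrDr.
have : M * ln (c * t / M) <= c * t.
  by rewrite [M * _]mulrC -ler_pdivlMr // ltW // ln_sublinear.
lra.
Qed.

(** Cyclicity of the trace turns each summand into the trace of [D Z E Z^T] with [Z = G^T Y_i H]. *)
Lemma trace_diag_congruence (R : realType) (m1 m2 n : nat)
    (Y : 'I_n -> 'M[R]_(m1, m2)) (G : 'M[R]_m1) (d : 'rV[R]_m1)
    (H : 'M[R]_m2) (e : 'rV[R]_m2) :
  \tr (G *m diag_mx d *m G^T *m
    \sum_i (Y i *m (H *m diag_mx e *m H^T) *m (Y i)^T)) =
  \sum_a \sum_b d 0 a * e 0 b * \sum_i ((G^T *m Y i *m H) a b) ^+ 2.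
Proof.
rewrite mulmx_sumr raddf_sum /=.
transitivity (\sum_i \sum_a \sum_b
    d 0 a * e 0 b * ((G^T *m Y i *m H) a b) ^+ 2); last first.
  rewrite exchange_big; apply: eq_bigr => a _.
  by rewrite exchange_big; apply: eq_bigr => b _; rewrite mulr_sumr.
apply: eq_bigr => i _; set Z := G^T *m Y i *m H.
have -> : G *m diag_mx d *m G^T *m (Y i *m (H *m diag_mx e *m H^T) *m (Y i)^T) =
   G *m (diag_mx d *m Z *m diag_mx e *m H^T *m (Y i)^T).
  by rewrite /Z !mulmxA.
rewrite mxtrace_mulC.
have -> : diag_mx d *m Z *m diag_mx e *m H^T *m (Y i)^T *m G =
    diag_mx d *m Z *m diag_mx e *m Z^T.
  by rewrite /Z !trmx_mul trmxK !mulmxA.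
rewrite /mxtrace; apply: eq_bigr => a _; rewrite mxE; apply: eq_bigr => b _.
by rewrite mul_mx_diag mul_diag_mx !mxE; ring.
Qed.

Lemma det_congruence (R : realType) (m : nat) (G : 'M[R]_m) (d : 'rV[R]_m) :
  \det G ^+ 2 = 1 -> \det (G *m diag_mx d *m G^T) = \prod_i d 0 i.
Proof.
by move=> dG; rewrite !det_mulmx det_tr det_diag mulrAC -expr2 dG mul1r.
Qed.

Lemma shrinking_free_bounded (R : realType) (m1 m2 n : nat)
    (Y : 'I_n -> 'M[R]_(m1, m2)) :
  (0 < m1)%N -> (0 < m2)%N -> (0 < n)%N ->
  shrinking_free Y -> loglik_bounded_above Y.
Proof.
move=> m1_gt0 m2_gt0 n_gt0 /shrinking_free_gap [delta delta0 gap].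
(* If all relevant [q a b] were below [eps], their sum would be at most [M eps < delta]; the added
   [1] makes this strict. *)
pose M : R := (m1 * m2)%:R; pose eps := delta / (M + 1).
have M0 : 0 < M by rewrite ltr0n muln_gt0 m1_gt0.
have eps0 : 0 < eps by rewrite divr_gt0 // addr_gt0.
exists (M * ln (M / (n%:R^-1 * eps))) => _ [[Psi1 Psi2] [/= pd1 pd2] <-].
have [G [d [G1 detG d0 ->]]] := PD_pivoted_LDL pd1.
have [H [e [H1 detH e0 ->]]] := PD_pivoted_LDL pd2.
rewrite /loglik !det_congruence // trace_diag_congruence !ln_prod //.
set q := fun a b => \sum_i ((G^T *m Y i *m H) a b) ^+ 2.
have q0 a b : 0 <= q a b by apply: sumr_ge0 => i _; apply: sqr_ge0.
set tau := \sum_a \sum_b _.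
have tau_ge a b : d 0 a * e 0 b * q a b <= tau.
  have s0 a' b' : 0 <= d 0 a' * e 0 b' * q a' b'.
    by rewrite mulr_ge0 // mulr_ge0 // ltW.
  rewrite /tau (bigD1 a) //= (bigD1 b) //= -addrA lerDl.
  rewrite addr_ge0 // sumr_ge0 // => *.
  exact: sumr_ge0.
have heavy (T : {set 'I_m1}) (S : {set 'I_m2}) : (#|T| * m2 < #|S| * m1)%N ->
    exists a b, [/\ a \notin T, b \in S & eps <= q a b].
  move=> lt_TS; apply: contrapT => light.
  have := gap T S G H lt_TS (conj G1 detG) (conj H1 detH).
  apply/negP; rewrite -ltNge.
  apply: (@le_lt_trans _ _ (\sum_(a : 'I_m1) \sum_(b : 'I_m2) eps)); last first.
    rewrite !sumr_const !card_ord -mulrnA mulnC -mulr_natl /eps mulrCA.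
    rewrite gtr_pMr //.
    by rewrite ltr_pdivrMr ?mul1r ?ltrDl // addr_gt0.
  rewrite big_mkcond; apply: ler_sum => a _; rewrite inE.
  case: ifPn => aT; last by rewrite sumr_ge0 // => *; apply: ltW.
  rewrite big_mkcond; apply: ler_sum => b _; case: ifPn => bS; last exact: ltW.
  by rewrite leNgt; apply/negP => /ltW le_eq; apply: light; exists a, b.
(* The empty [T] and the full [S] satisfy the strict inequality, so some [q a b] is positive. *)
have tau0 : 0 < tau.
  have [|a [b [_ _ qab]]] := heavy finset.set0 [set: 'I_m2].

    by rewrite cards0 cardsT card_ord mul0n muln_gt0 m2_gt0.
  apply: lt_le_trans (tau_ge a b); rewrite mulr_gt0 ?mulr_gt0 //.
  exact: lt_le_trans qab.
apply: le_trans (log_linear_le M0 _ eps0 tau0); last by rewrite invr_gt0 ltr0n.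
rewrite lerB //; apply: weighted_sum_le => T S /heavy[a [b [aT bS qab]]].
exists a, b; split => //.
rewrite -lnM ?posrE // ler_ln ?posrE ?mulr_gt0 ?invr_gt0 //.
rewrite ler_pdivlMr //; apply: le_trans (tau_ge a b).
by rewrite ler_pM2l // mulr_gt0.
Qed.

(** * From the bound to the dimension count *)

(** This keeps the denominator [m1 - l] positive: [ceil x - 1 < x], and [x = m1 k / m2 <= m1]. *)
Lemma lk_lt (m1 m2 k : nat) : (0 < m2)%N -> (k <= m2)%N -> (0 < m1)%N ->
  (lk m1 m2 k)%:~R < m1%:R :> rat.
Proof.
move=> m2_gt0 km2 m1_gt0.
have m2Q : 0 < m2%:R :> rat by rewrite ltr0n.
apply: lt_le_trans (_ : m1%:R / m2%:R * k%:R <= _).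
  exact: ceilB1_lt.
by rewrite mulrAC ler_pdivrMr // ler_wpM2l ?ler0n // ler_nat.
Qed.

(** [l] is the largest integer strictly below [m1 k / m2]. *)
Lemma le_lk (m1 m2 k t : nat) : (0 < m2)%N -> (t * m2 < k * m1)%N ->
  t%:R <= (lk m1 m2 k)%:~R :> rat.
Proof.
move=> m2_gt0 lt_tk; rewrite -[t%:R]/(t%:Z%:~R) ler_int /lk lerBrDr lezD1.
by rewrite ceil_gt_int mulrAC ltr_pdivlMr ?ltr0n // -!natrM ltr_nat (mulnC m1).
Qed.

Lemma bound_term_le_mlt_bound (m1 m2 k : nat) : (0 < k <= m2)%N ->
  bound_term m1 m2 k <= mlt_bound m1 m2.
Proof.
move=> km2; rewrite /mlt_bound.
by apply: (le_bigmax_seq _ k) => //; rewrite mem_index_iota.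
Qed.

(** Dividing the count by [(m1 - t) k] gives [t / k + (m2 - k) / (m1 - t) < n]. The left side is
    nondecreasing in [t < m1], so the worst case is [t = l]. *)
Lemma mlt_bound_dimension_count (m1 m2 n k t : nat) : (0 < m2)%N ->
  mlt_bound m1 m2 < n%:R -> (k <= m2)%N -> (t * m2 < k * m1)%N ->
  (k * (m2 - k) + (m1 - t) * t < n * ((m1 - t) * k))%N.
Proof.
move=> m2_gt0 lt_n km2 lt_tk.
have [k_gt0 m1_gt0] : (0 < k)%N /\ (0 < m1)%N.
  by apply/andP; rewrite -muln_gt0; apply: leq_ltn_trans lt_tk.
have Lm1 := lk_lt m2_gt0 km2 m1_gt0; have tL := le_lk m2_gt0 lt_tk.
have tm1 : (t < m1)%N by rewrite -(ltr_nat rat); apply: le_lt_trans Lm1.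
have k_itv : (0 < k <= m2)%N by rewrite k_gt0.
have := le_lt_trans (bound_term_le_mlt_bound m1 k_itv) lt_n.
rewrite /bound_term; set L := (lk m1 m2 k)%:~R in Lm1 tL *.
have k0 : 0 < k%:R :> rat by rewrite ltr0n.
have q0 : 0 < m1%:R - t%:R :> rat by rewrite subr_gt0 ltr_nat.
have bk : t%:R / k%:R <= L / k%:R by rewrite ler_pM2r ?invr_gt0.
have bq : (m2%:R - k%:R) / (m1%:R - t%:R) <=
    (m2%:R - k%:R) / (m1%:R - L) :> rat.
  rewrite ler_wpM2l ?subr_ge0 ?ler_nat //.
  by rewrite lef_pV2 ?posrE ?subr_gt0 ?ltr_nat // lerD2l lerN2.
move=> /(le_lt_trans (lerD bk bq)).
have -> : t%:R / k%:R + (m2%:R - k%:R) / (m1%:R - t%:R) =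
    (k%:R * (m2%:R - k%:R) + (m1%:R - t%:R) * t%:R) /
    ((m1%:R - t%:R) * k%:R) :> rat.
  by field; rewrite !gt_eqF.
rewrite ltr_pdivrMr ?mulr_gt0 // -(natrB _ km2) -(natrB _ (ltnW tm1)).
by rewrite -!natrM -natrD ltr_nat.
Qed.

(** This makes every [n] above the bound positive, and the floor plus one a natural number. *)
Lemma mlt_bound_ge0 (m1 m2 : nat) :
  (0 < m2)%N -> (0 < m1)%N -> 0 <= mlt_bound m1 m2.
Proof.
move=> m2_gt0 m1_gt0.
have k1 : (0 < 1 <= m2)%N by [].
apply: le_trans (bound_term_le_mlt_bound m1 k1).
have Lm1 := lk_lt m2_gt0 m2_gt0 m1_gt0.
have tL : 0%:R <= (lk m1 m2 1)%:~R :> rat.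
  by apply: le_lk => //; rewrite mul0n mul1n.
by rewrite addr_ge0 ?divr_ge0 ?subr_ge0 ?ler_nat // ltW.
Qed.

Theorem corollary4p9 (R : realType) (m1 m2 : nat)
    (m2_gt0 : (0 < m2)%N) (le_m2_m1 : (m2 <= m1)%N) :
  (forall n : nat, mlt_bound m1 m2 < n%:R ->
     generically_bounded_above R m1 m2 n) /\
  (exists2 N : nat, is_mltb R m1 m2 N &
     N%:Z <= Num.floor (mlt_bound m1 m2) + 1).
Proof.
have m1_gt0 : (0 < m1)%N by apply: leq_trans le_m2_m1.
have B0 := mlt_bound_ge0 m2_gt0 m1_gt0.
have bounded (n : nat) :
    mlt_bound m1 m2 < n%:R -> generically_bounded_above R m1 m2 n.
  move=> lt_n; have n_gt0 : (0 < n)%N.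
    by rewrite -(ltr_nat rat); apply: le_lt_trans lt_n.
  have lt_dim k t := @mlt_bound_dimension_count m1 m2 n k t m2_gt0 lt_n.
  apply: generically_sub (generically_shrinking_free R lt_dim) => Y.
  exact: shrinking_free_bounded.
split=> //.
pose N0 := absz (Num.floor (mlt_bound m1 m2) + 1).
have N0E : N0%:Z = Num.floor (mlt_bound m1 m2) + 1.
  by rewrite gez0_abs // addr_ge0 // floor_ge0.
have lt_N0 : mlt_bound m1 m2 < N0%:R.
  by rewrite -[N0%:R]/(N0%:Z%:~R) N0E floorD1_gt.
(* The threshold is the least good size. It exists because [N0] is good, and minimality gives
   [N <= N0]. *)
pose good N := (0 < N)%N && `[< generically_bounded_above R m1 m2 N >].
have exgood : exists N, good N.
  exists N0; apply/andP; split; last by apply/asboolP; apply: bounded.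
  by rewrite -(ltr_nat rat); apply: le_lt_trans lt_N0.
case: (ex_minnP exgood) => N /andP[N_gt0 /asboolP gN] minN.
exists N.
  split=> // n n_gt0 gn; apply: minN.
  by apply/andP; split => //; apply/asboolP.
rewrite -N0E lez_nat; apply: minN; apply/andP.
split; last by apply/asboolP; apply: bounded.
by rewrite -(ltr_nat rat); apply: le_lt_trans lt_N0.
Qed.
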